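(* Let $G=(V,E)$ be a cycle hypergraph. Then $\operatorname{VAW}(G)\le 6$.
   Context: A hypergraph $G=(V,E)$ has finite vertex set $V$ and a set $E$ of hyperedges $e\subseteq V$ with $|e|\ge2$. A cycle hypergraph is one whose hyperedges can be ordered cyclically so that each hyperedge intersects only its two cyclic neighbors. That is, $E=\{e_0,\ldots,e_L\}$ with $L\ge2$ and distinct $e_j$, indices taken modulo $L+1$, and for $j\ne k$ one has $e_j\cap e_k\ne\emptyset$ if and only if $k\equiv j\pm1 \pmod{L+1}$. Valid-antichain width. For a vertex order $\sigma=(v_1,\ldots,v_n)$ of $V$ ($n=|V|$) and $i\in\{0,\ldots,n\}$, let $U_0=\emptyset$, $U_i=\{v_1,\ldots,v_i\}$, $\mathcal{A}_i=\{e\in E:e\cap U_i\ne\emptyset,\ e\nsubseteq U_i\}$ (active hyperedges), $\rho_i(e)=e\cap U_i$ for $e\in\mathcal{A}_i$, and $\mathcal{R}_i=\{\rho_i(e):e\in\mathcal{A}_i\}$, partially ordered by inclusion. An antichain $\mathcal{C}\subseteq\mathcal{R}_i$ is a (possibly empty) set of pairwise incomparable elements; with $X(\mathcal{C})=\bigcup_{R\in\mathcal{C}}R$, it is valid if for every $R\in\mathcal{R}_i$ with $R\subseteq X(\mathcal{C})$ there exists $M\in\mathcal{C}$ with $R\subseteq M$. Let $\operatorname{VA}_i(\sigma)$ be the set of valid antichains of $(\mathcal{R}_i,\subseteq)$, $W(\sigma)=\max_i|\operatorname{VA}_i(\sigma)|$, and $\operatorname{VAW}(G)=\min_\sigma W(\sigma)$,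 the minimum over all vertex orders. *)

(* Defs.v *)
From mathcomp Require Import all_boot.

Set Implicit Arguments.
Unset Strict Implicit.
Unset Printing Implicit Defensive.

Record hypergraph (V : finType) := Hypergraph {
  hyperedges : {set {set V}};
  _ : {in hyperedges, forall e : {set V}, 2 <= #|e|}
}.

(* In the last condition [j == k.+1 %[mod L.+1]] encodes k = j - 1 mod L + 1,
   avoiding truncated subtraction. *)
Definition is_cycle_hypergraph (V : finType) (G : hypergraph V) : Prop :=
  exists L : nat, 2 <= L /\
  exists e : 'I_L.+1 -> {set V},
    [/\ injective e,
        hyperedges G = [set e j | j : 'I_L.+1] &
        forall j k : 'I_L.+1, j != k ->
          (e j :&: e k != set0) =
          (k == j.+1 %[mod L.+1]) || (j == k.+1 %[mod L.+1])].

Section ValidAntichains.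

Variables (V : finType) (G : hypergraph V).

(* A vertex order is a duplicate-free sequence s of length #|V|; the
   definitions below make sense for arbitrary sequences, and [uniq] is imposed
   in [VAW]. *)
Definition initial_set (s : seq V) (i : nat) : {set V} :=
  [set x in take i s].

Definition active (s : seq V) (i : nat) : {set {set V}} :=
  [set e in hyperedges G | (e :&: initial_set s i != set0)
                           && ~~ (e \subset initial_set s i)].

Definition traces (s : seq V) (i : nat) : {set {set V}} :=
  [set e :&: initial_set s i | e in active s i].

Definition is_antichain (C : {set {set V}}) : bool :=
  [forall A in C, forall B in C, (A \subset B) ==> (A == B)].

(* [cover C] is the union of the members of C. *)
Definition is_valid (RR C : {set {set V}}) : bool :=
  [forall R in RR, (R \subset cover C) ==> [exists M in C, R \subset M]].

Definition valid_antichains (s : seq V) (i : nat) : {set {set {set V}}} :=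
  [set C : {set {set V}} | [&& C \subset traces s i, is_antichain C
                             & is_valid (traces s i) C]].

Definition order_width (s : seq V) : nat :=
  \max_(i < #|V|.+1) #|valid_antichains s i|.

(* The enumeration of V is itself a vertex order, so the minimum below is over
   a nonempty set. *)
Definition VAW : nat :=
  order_width [arg min_(s < enum_tuple V | uniq s) order_width s].

End ValidAntichains.

(* Main.v *)
Require Import Defs.
From mathcomp Require Import all_boot.

Set Implicit Arguments.
Unset Strict Implicit.
Unset Printing Implicit Defensive.

(** Sweep once around the cycle: let the rank of a vertex [v] be the least [j]
    with [v \in e j], and take any order along which the rank does not decrease.
    When the prefix [U] has reached the rank [m], every hyperedge of index below
    [m] lies inside [U], while a hyperedge of index [k > m] can meet [U] only by
    meeting some [e i] with [i <= m].  By the cycle condition this forces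
    [k = m.+1], or else [k = L] with [i = 0].  So there are at most three traces,
    those of [e m], [e m.+1] and [e L].  Moreover, if [m.+1 < L], every vertex of
    [U] in [e m.+1] has rank exactly [m], so the trace of [e m.+1] is contained
    in that of [e m] ([sweep_traces]).

    Among three sets [A], [B], [C] with [B \subset A], an antichain cannot
    contain both [A] and [B] unless they are equal, which leaves only the empty
    family, the three singletons, and the pairs [A, C] and [B, C]
    ([antichains_le6]). *)

Lemma subset_set2 (T : finType) (X Y : T) (D : {set T}) :
  D \subset [set X; Y] -> D \in [:: set0; [set X]; [set Y]; [set X; Y]].
Proof.
move=> sD; rewrite !inE.
have DE x : (x \in D) = (x == X) && (X \in D) || (x == Y) && (Y \in D).
  case: (eqVneq x X) => [->|nX]; case: (eqVneq _ Y) => [e|nY] //=.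
  - by rewrite e orbb.
  - by rewrite orbF.
  - by rewrite e.
  - by apply/negbTE/negP => /(subsetP sD); rewrite !inE (negPf nX) (negPf nY).
case XD: (X \in D) DE; case YD: (Y \in D) => DE; apply/or4P.
- by apply: Or44; apply/eqP/setP => x; rewrite DE !inE !andbT.
- by apply: Or42; apply/eqP/setP => x; rewrite DE !inE andbT andbF orbF.
- by apply: Or43; apply/eqP/setP => x; rewrite DE !inE andbT andbF.
- by apply: Or41; apply/eqP/setP => x; rewrite DE !inE !andbF.
Qed.

(** An antichain misses [A] or [B] (or they coincide), so it is a subfamily of
    [A, C] or of [B, C]; each pair has four subfamilies, and the empty one and
    that of [C] alone are common to both. *)
Lemma antichains_le6 (T : finType) (A B C : {set T}) :
  B \subset A ->
  #|[set D : {set {set T}} | (D \subset [set A; B; C]) && is_antichain D]| <= 6.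
Proof.
move=> sBA.
pose families : seq {set {set T}} :=
  [:: set0; [set A]; [set B]; [set C]; [set A; C]; [set B; C]].
apply: leq_trans (card_size families); apply: subset_leq_card.
apply/subsetP => D; rewrite inE => /andP[/subsetP sD /forall_inP antiD].
have: (D \subset [set A; C]) || (D \subset [set B; C]).
  have [AD|nAD] := boolP (A \in D).
    apply/orP; left; apply/subsetP => X XD.
    have := sD X XD; rewrite !inE -orbA => /or3P[->||->]; rewrite ?orbT //.
    move=> /eqP XB; rewrite {}XB in XD *.
    by have /forall_inP/(_ A AD)/implyP/(_ sBA)-> := antiD B XD.
  apply/orP; right; apply/subsetP => X XD.
  have := sD X XD; rewrite !inE -orbA => /or3P[/eqP XA|->|->]; rewrite ?orbT //.
  by rewrite -XA XD in nAD.
by case/orP => /subset_set2; rewrite !inE => /or4P[] ->; rewrite ?orbT.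
Qed.

(** A prefix of an [f]-sorted sequence is a threshold cut for [f], up to ties at
    the threshold. *)
Lemma sorted_prefix_threshold (T : eqType) (f : T -> nat) (s : seq T) (i : nat) :
  sorted (relpre f leq) s ->
  exists m, {in take i s, forall x, f x <= m} /\
            {in drop i s, forall x, m <= f x}.
Proof.
rewrite sorted_pairwise; last by move=> y x z /=; apply: leq_trans.
rewrite -{1}(cat_take_drop i s) pairwise_cat => /andP[/allrelP le_f _].
exists (\max_(x <- take i s) f x); split=> x xs.
  exact: leq_bigmax_seq.
by apply/bigmax_leqP_seq => y ys _; apply: le_f.
Qed.

Section Sweep.

Variables (V : finType) (L : nat) (e : 'I_L.+1 -> {set V}).

(** Vertices in no hyperedge get rank [L.+1], hence come last. *)
Definition rank (v : V) : nat := find (fun j => v \in e j) (enum 'I_L.+1).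

Lemma rank_le (v : V) (j : 'I_L.+1) : v \in e j -> rank v <= j.
Proof.
move=> vj; rewrite leqNgt; apply/negP => /(before_find ord0).
by rewrite nth_ord_enum vj.
Qed.

Lemma rank_mem (v : V) (j : 'I_L.+1) :
  v \in e j -> exists2 i : 'I_L.+1, rank v = i & v \in e i.
Proof.
move=> vj.
have has_v : has (fun j => v \in e j) (enum 'I_L.+1).
  by apply/hasP; exists j; rewrite ?mem_enum.
have ltL : rank v < L.+1 by move: has_v; rewrite has_find size_enum_ord.
exists (Ordinal ltL) => //.
by have := nth_find ord0 has_v; rewrite -[find _ _]/(val (Ordinal ltL)) nth_ord_enum.
Qed.

Definition sweep : seq V := sort (relpre rank leq) (enum V).

Lemma sweep_uniq : uniq sweep.
Proof. by rewrite sort_uniq enum_uniq. Qed.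

Lemma size_sweep : size sweep == #|V|.
Proof. by rewrite size_sort cardE. Qed.

Lemma sweep_threshold (i : nat) :
  exists m, (forall v, v \in initial_set sweep i -> rank v <= m) /\
            (forall v, rank v < m -> v \in initial_set sweep i).
Proof.
have /(sorted_prefix_threshold i)[m [le_m ge_m]] : sorted (relpre rank leq) sweep.
  by apply: sort_sorted => x y; apply: leq_total.
exists m; split=> v; first by rewrite inE; apply: le_m.
apply: contraTT; rewrite inE -leqNgt => nv; apply: ge_m.
have: v \in sweep by rewrite mem_sort mem_enum.
by rewrite -{1}(cat_take_drop i sweep) mem_cat (negPf nv).
Qed.

Hypothesis e_adj : forall j k : 'I_L.+1, j != k ->
  (e j :&: e k != set0) =
  (k == j.+1 %[mod L.+1]) || (j == k.+1 %[mod L.+1]).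

Lemma adjacent_lt (j k : 'I_L.+1) (v : V) :
  v \in e j -> v \in e k -> j < k -> k = j.+1 :> nat \/ k = L :> nat.
Proof.
move=> vj vk ltjk.
have njk : j != k by rewrite -val_eqE /= ltn_eqF.
have [ltkL|leLk] := ltnP k L; last first.
  by right; apply/anti_leq; rewrite leLk -ltnS ltn_ord.
have: e j :&: e k != set0 by apply/set0Pn; exists v; rewrite inE vj.
have ltjL := ltn_trans ltjk ltkL.
rewrite (e_adj njk) !modn_small ?ltn_ord //.
case/orP => /eqP E; first by left.
by move: ltjk; rewrite E ltnNge leqnSn.
Qed.

Variable G : hypergraph V.
Hypothesis edgesG : hyperedges G = [set e j | j : 'I_L.+1].

Lemma sweep_traces (i : nat) :
  exists A B C : {set V}, B \subset A /\ traces G sweep i \subset [set A; B; C].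
Proof.
have [m [le_m lt_m]] := sweep_threshold i.
set U := initial_set sweep i in le_m lt_m *.
have activeE (k : 'I_L.+1) v : v \in e k -> v \in U -> ~~ (e k \subset U) ->
    [\/ k = m :> nat, k = m.+1 :> nat | k = L :> nat].
  move=> vk vU nsub; have lemk : m <= k.
    rewrite leqNgt; apply: contra nsub => ltkm; apply/subsetP => w wk.
    by apply: lt_m; apply: leq_ltn_trans (rank_le wk) ltkm.
  have [j rj vj] := rank_mem vk.
  have lejm : j <= m by rewrite -rj le_m.
  move: lemk; rewrite leq_eqVlt => /predU1P[<-|ltmk]; first exact: Or31.
  have [kj|kL] := adjacent_lt vj vk (leq_ltn_trans lejm ltmk); last exact: Or33.
  by apply: Or32; apply/anti_leq; rewrite ltmk andbT kj ltnS.
pose tr j := e (inord j) :&: U.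
have trE (k : 'I_L.+1) : tr k = e k :&: U by rewrite /tr inord_val.
(* When m.+1 >= L, the index m.+1 contributes nothing besides L itself, and any
   subset of tr m can stand for B. *)
exists (tr m), (if m.+1 < L then tr m.+1 else set0), (tr L); split.
  case: ifP => [ltmL|_]; last exact: sub0set.
  apply/subsetP => v; rewrite !in_setI => /andP[vk vU].
  rewrite vU andbT; have [j rj vj] := rank_mem vk.
  have lejm : j <= m by rewrite -rj le_m.
  have kS : (inord m.+1 : 'I_L.+1) = m.+1 :> nat by rewrite inordK // ltnW.
  have ltjk : j < (inord m.+1 : 'I_L.+1) by rewrite kS ltnS.
  have [|] := adjacent_lt vj vk ltjk; rewrite kS.
    by case=> ->; rewrite inord_val.
  by move=> E; rewrite E ltnn in ltmL.
apply/subsetP => X /imsetP[F]; rewrite inE edgesG.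
case/andP => /imsetP[k _ ->] /andP[/set0Pn[v]].
rewrite inE => /andP[vk vU] nsub -> {X F}.
rewrite -/U -trE !inE; have [->|km|->] := activeE k v vk vU nsub.
- by rewrite eqxx.
- have: k <= L by rewrite -ltnS.
  rewrite km leq_eqVlt => /predU1P[->|->]; by rewrite eqxx ?orbT.
- by rewrite eqxx orbT.
Qed.

End Sweep.

Lemma VAW_le (V : finType) (G : hypergraph V) (s : #|V|.-tuple V) :
  uniq s -> VAW G <= order_width G s.
Proof.
move=> us; rewrite /VAW; case: arg_minnP => [|t _]; first exact: enum_uniq.
exact.
Qed.

Theorem proposition2 (V : finType) (G : hypergraph V)
    (cycG : is_cycle_hypergraph G) :
  VAW G <= 6.
Proof.
have [L [_ [e [_ edgesG e_adj]]]] := cycG.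
apply: leq_trans (VAW_le G (s := Tuple (size_sweep e)) (sweep_uniq e)) _.
apply/bigmax_leqP => i _ /=.
have [A [B [C [sBA sub]]]] := sweep_traces e_adj edgesG i.
apply: leq_trans (antichains_le6 C sBA); apply: subset_leq_card.
by apply/subsetP => D; rewrite !inE => /and3P[/subset_trans/(_ sub)-> ->].
Qed.
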